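(* Let $T:\mathbb{R}^n\to\mathbb{R}^n$ be Lipschitz continuous with constant $L>0$, i.e. $|T(x_1)-T(x_2)|_2\le L\,|x_1-x_2|_2$ for all $x_1,x_2\in\mathbb{R}^n$. Let $x^0,x^1,\dots,x^k\in\mathbb{R}^n$ ($k\ge 1$) be iterates of the Alternating Anderson-Picard (AAP) method for $T(x)=0$, let $f^j=T(x^j)$ be the $j$-th residual, and let $\Delta x^j=x^j-x^{j-1}$, $\Delta f^j=f^j-f^{j-1}$ for $1\le j\le k$. Let $P_1,\dots,P_k\in\mathbb{R}^{n\times n}$ be the projection operators induced by the sketching (masking) operators, and let $F^k=[\Delta f^1,\dots,\Delta f^k]$. Define the perturbed matrix and the perturbed residual $$\hat F^k=F^k+\delta F^k,\quad \delta F^k=-\left[(I-P_1)\Delta f^1,\dots,(I-P_k)\Delta f^k\right],\qquad \hat f^k=f^k+\delta f^k,\quad \delta f^k=-(I-P_k)f^k .$$ Let $\hat F^k=\hat Q^k\hat R^k$ be the QR factorization of $\hat F^k$, let $\hat\alpha^k=[\hat F^k]^\dagger\hat f^k$ be the solution of the perturbed least-squares problem, and define the perturbation norm $\delta^k=|\delta F^k\hat\alpha^k|_2$. Let $\epsilon>0$ be a scalar (the tolerable perturbation magnitude) and let $(\eta_j)_{j\ge 1}$ be an arbitrary sequence such that $\sum_{j=1}^\infty\eta_j=C$ for some positive scalar $C$. Assume that: 1. $|\delta f^k|_2\le\epsilon\,|f^k|_2$; 2. for all $j\in\{1,\dots,k\}$, $$\|I-P_j\|\le\eta_j\,\frac{\sigma_{\min}(\hat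 R^k)}{L\,|f^k|_2\,|\Delta x^j|_2\,(1+\epsilon)} .$$ Then $\delta^k\le C$.
   Context: Notation: $|\cdot|_2$ is the Euclidean norm on $\mathbb{R}^n$ (or $\mathbb{R}^k$), $\|\cdot\|$ is the induced operator norm, and $\sigma_{\min}(Z)$ is the smallest singular value of a matrix $Z$. For a matrix $Z$ of full column rank, $Z^\dagger=(Z^TZ)^{-1}Z^T$ is the Moore-Penrose pseudo-inverse. The QR factorization $\hat F^k=\hat Q^k\hat R^k$ is the reduced one: $\hat Q^k\in\mathbb{R}^{n\times k}$ has orthonormal columns and $\hat R^k\in\mathbb{R}^{k\times k}$ is upper triangular. As implicit in the use of the pseudo-inverse formula and of the quotient in hypothesis 2, $\hat F^k$ has full column rank (so $\hat R^k$ is invertible), $f^k\ne 0$ and $\Delta x^j\neq 0$ for $1\le j\le k$. Sketching operators: a masking (restriction) operator is a linear map $\Pi:\mathbb{R}^n\to\mathbb{R}^\ell$, $\ell\le n$, that extracts a subset of $\ell$ coordinates. Its induced projection operator is $P=\Pi^T\Pi\in\mathbb{R}^{n\times n}$, i.e. the diagonal $0/1$ matrix that keeps the selected entries and sets the others to zero. Each $P_j$ is of this form, and the selected coordinates may depend on $j$. AAP method: given $x^0$, a relaxation parameter $\omega>0$, and an alternation parameter $p\ge 1$, set $f^j=T(x^j)$, $g^j=x^j-\omega f^j$ and $x^1=x^0-f^0$. For $j\ge 1$, if $j$ is not a multiple of $p$, perform a Picard step $x^{j+1}=x^j-\omega f^j$. If $j$ is a multiple of $p$, perform an Anderson mixing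 step $x^{j+1}=x^j-\omega f^j+G^j\alpha$, where $G^j=[\Delta g^1,\dots,\Delta g^j]$, $\Delta g^i=g^i-g^{i-1}$, and $\alpha$ is the vector of mixing weights obtained by minimizing $|F^j\alpha-f^j|_2$ with $F^j=[\Delta f^1,\dots,\Delta f^j]$, or, in the sketched version of the method, by minimizing the perturbed objective $|\hat F^j\alpha-\hat f^j|_2$, with $\hat F^j,\hat f^j$ defined from $P_1,\dots,P_j$ as in the claim (with $k$ replaced by $j$).
   Formalization: The terms η_j with j > k are assumed nonnegative; for an arbitrary signed sequence with sum C the claim is false, since a large η_1 followed by a negative η_2 can make C smaller than δ^k. *)

(* Defs.v *)
From HB Require Import structures.
From mathcomp Require Import all_boot all_order all_algebra.
From mathcomp Require Import all_classical all_reals all_analysis.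

Set Implicit Arguments.
Unset Strict Implicit.
Unset Printing Implicit Defensive.

Import Order.TTheory GRing.Theory Num.Theory.
Import numFieldNormedType.Exports.

Local Open Scope classical_set_scope.
Local Open Scope ring_scope.

(* The canonical norm on matrices, `|v|, is the max norm; the Euclidean norm
   and everything built on it is therefore spelled out here. *)
Definition enorm (R : realType) (n : nat) (v : 'cV[R]_n) : R :=
  Num.sqrt (\sum_i v i 0 ^+ 2).

(* The set is nonempty and bounded above, so its [sup] is the actual one. *)
Definition opnorm (R : realType) (m n : nat) (A : 'M[R]_(m, n)) : R :=
  sup [set enorm (A *m v) | v in [set v : 'cV[R]_n | enorm v <= 1]].

(* For n <= m: a wide matrix would get spurious zero singular values. *)
Definition singular_value (R : realType) (m n : nat) (Z : 'M[R]_(m, n))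
    (s : R) : Prop :=
  0 <= s /\ eigenvalue (Z^T *m Z) (s ^+ 2).

(* For 0 < n the set of singular values is finite and nonempty, so that this
   infimum is a minimum. *)
Definition sigma_min (R : realType) (m n : nat) (Z : 'M[R]_(m, n)) : R :=
  inf [set s | singular_value Z s].

(* Moore-Penrose inverse of a matrix of full column rank ([pinvmx] is a
   different object: an arbitrary partial inverse). *)
Definition pseudo_inverse (R : realType) (m n : nat) (Z : 'M[R]_(m, n)) :
    'M[R]_(n, m) :=
  invmx (Z^T *m Z) *m Z^T.

(* [is_trig_mx] means lower triangular. *)
Definition reduced_QR (R : realType) (m n : nat) (A Q : 'M[R]_(m, n))
    (U : 'M[R]_n) : Prop :=
  [/\ A = Q *m U, Q^T *m Q = 1%:M & is_trig_mx U^T].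

(* The masking operator extracting the coordinates s 0, ..., s (l - 1) is the
   matrix whose rows are the corresponding rows of the identity; injectivity of
   s forces l <= n. *)
Definition masking (R : realType) (l n : nat) (Pi : 'M[R]_(l, n)) : Prop :=
  exists2 s : 'I_l -> 'I_n, injective s & Pi = rowsub s 1%:M.

Definition masking_projection (R : realType) (n : nat) (P : 'M[R]_n) : Prop :=
  exists l : nat, exists2 Pi : 'M[R]_(l, n), masking Pi & P = Pi^T *m Pi.

(* Backward difference u^j - u^(j-1), meaningful for 1 <= j. *)
Definition bdiff (V : zmodType) (u : nat -> V) (j : nat) : V := u j - u j.-1.

(* [Delta u^1, ..., Delta u^j]: the column of index i : 'I_j is
   Delta u^(i + 1). *)
Definition diff_mx (R : realType) (n : nat) (u : nat -> 'cV[R]_n) (j : nat) :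
    'M[R]_(n, j) :=
  \matrix_(a < n, i < j) bdiff u i.+1 a 0.

Definition delta_mx_sketch (R : realType) (n : nat) (P : nat -> 'M[R]_n)
    (f : nat -> 'cV[R]_n) (j : nat) : 'M[R]_(n, j) :=
  - \matrix_(a < n, i < j) ((1%:M - P i.+1) *m bdiff f i.+1) a 0.

Definition delta_res_sketch (R : realType) (n : nat) (P : nat -> 'M[R]_n)
    (f : nat -> 'cV[R]_n) (j : nat) : 'cV[R]_n :=
  - ((1%:M - P j) *m f j).

Definition sketched_mx (R : realType) (n : nat) (P : nat -> 'M[R]_n)
    (f : nat -> 'cV[R]_n) (j : nat) : 'M[R]_(n, j) :=
  diff_mx f j + delta_mx_sketch P f j.

Definition sketched_res (R : realType) (n : nat) (P : nat -> 'M[R]_n)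
    (f : nat -> 'cV[R]_n) (j : nat) : 'cV[R]_n :=
  f j + delta_res_sketch P f j.

Definition least_squares (R : realType) (m n : nat) (A : 'M[R]_(m, n))
    (b : 'cV[R]_m) (alpha : 'cV[R]_n) : Prop :=
  forall beta : 'cV[R]_n, enorm (A *m alpha - b) <= enorm (A *m beta - b).

(* x^0, ..., x^k are AAP iterates for T(x) = 0, in the original version
   ([sketched = false]) or in the sketched one ([sketched = true]); the values
   of x beyond k are irrelevant. When the least-squares problem of a mixing
   step has several minimizers, any of them may be used. *)
Definition AAP_iterates (R : realType) (n : nat) (T : 'cV[R]_n -> 'cV[R]_n)
    (omega : R) (p : nat) (sketched : bool) (P : nat -> 'M[R]_n) (k : nat)
    (x : nat -> 'cV[R]_n) : Prop :=
  let f j := T (x j) in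
  let g j := x j - omega *: f j in
  x 1%N = x 0%N - f 0%N /\
  forall j : nat, (0 < j < k)%N ->
    if (p %| j)%N then
      exists2 alpha : 'cV[R]_j,
        (if sketched then
           least_squares (sketched_mx P f j) (sketched_res P f j) alpha
         else least_squares (diff_mx f j) (f j) alpha) &
        x j.+1 = x j - omega *: f j + diff_mx g j *m alpha
    else x j.+1 = x j - omega *: f j.

(* Main.v *)
(** Writing alpha for the perturbed weights, delta F^k alpha is minus the sum
    of the vectors alpha_j (I - P_j) Delta f^j, hence
      delta^k <= sum_j |alpha_j| ||I - P_j|| L |Delta x^j|.
    From F = Q U one gets alpha = U^-1 Q^T b, where b is the perturbed
    residual, so that sigma_min(U) |alpha| <= |Q^T b| <= |b| <=
    (1 + epsilon) |f^k|; with the bound on ||I - P_j|| the j-th term is then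
    at most eta_j.  The nonnegativity of eta_j rests on sigma_min(U) > 0. *)

Require Import Defs.
From mathcomp Require Import all_boot all_order all_algebra.
From mathcomp Require Import all_classical all_reals all_analysis.
From mathcomp Require Import ring lra.
Set Implicit Arguments.
Unset Strict Implicit.
Unset Printing Implicit Defensive.
Import Order.TTheory GRing.Theory Num.Theory.
Import numFieldNormedType.Exports.
Local Open Scope classical_set_scope.
Local Open Scope ring_scope.

(** * Euclidean inner product and norm *)

Definition dot {R : realType} {n : nat} (u v : 'cV[R]_n) : R := (u^T *m v) 0 0.

Lemma dotE (R : realType) (n : nat) (u v : 'cV[R]_n) :
  dot u v = \sum_i u i 0 * v i 0.
Proof. by rewrite /dot mxE; apply: eq_bigr => i _; rewrite mxE. Qed.

Lemma dotC (R : realType) (n : nat) (u v : 'cV[R]_n) : dot u v = dot v u.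
Proof. by rewrite !dotE; apply: eq_bigr => i _; rewrite mulrC. Qed.

Lemma dotDr (R : realType) (n : nat) (u v w : 'cV[R]_n) :
  dot u (v + w) = dot u v + dot u w.
Proof. by rewrite /dot mulmxDr mxE. Qed.

Lemma dotZr (R : realType) (n : nat) (a : R) (u v : 'cV[R]_n) :
  dot u (a *: v) = a * dot u v.
Proof. by rewrite /dot -scalemxAr mxE. Qed.

Lemma dotDl (R : realType) (n : nat) (u v w : 'cV[R]_n) :
  dot (u + v) w = dot u w + dot v w.
Proof. by rewrite dotC dotDr !(dotC w). Qed.

Lemma dotZl (R : realType) (n : nat) (a : R) (u v : 'cV[R]_n) :
  dot (a *: u) v = a * dot u v.
Proof. by rewrite dotC dotZr (dotC v). Qed.

Lemma dot_mulmxr (R : realType) (m n : nat) (A : 'M[R]_(m, n))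
    (u : 'cV[R]_m) (v : 'cV[R]_n) : dot u (A *m v) = dot (A^T *m u) v.
Proof. by rewrite /dot trmx_mul trmxK mulmxA. Qed.

Lemma dotvv_ge0 (R : realType) (n : nat) (v : 'cV[R]_n) : 0 <= dot v v.
Proof. by rewrite dotE sumr_ge0 // => i _; rewrite -expr2 sqr_ge0. Qed.

Lemma enorm_ge0 (R : realType) (n : nat) (v : 'cV[R]_n) : 0 <= enorm v.
Proof. exact: sqrtr_ge0. Qed.

Lemma sqr_enorm (R : realType) (n : nat) (v : 'cV[R]_n) :
  enorm v ^+ 2 = dot v v.
Proof.
rewrite /enorm sqr_sqrtr; last by rewrite sumr_ge0 // => i _; rewrite sqr_ge0.
by rewrite dotE; apply: eq_bigr => i _; rewrite expr2.
Qed.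

Lemma enorm0 (R : realType) (n : nat) : enorm (0 : 'cV[R]_n) = 0.
Proof. by rewrite /enorm big1 ?sqrtr0 // => i _; rewrite mxE expr0n. Qed.

Lemma enorm_gt0 (R : realType) (n : nat) (v : 'cV[R]_n) :
  (0 < enorm v) = (v != 0).
Proof.
rewrite lt0r enorm_ge0 andbT; congr (~~ _).
apply/eqP/eqP => [v0|->]; last exact: enorm0.
have /eqP : dot v v = 0 by rewrite -sqr_enorm v0 expr0n.
rewrite dotE psumr_eq0 => [/allP v00|i _]; last by rewrite -expr2 sqr_ge0.
apply/colP => i; rewrite mxE.
by have /v00 := mem_index_enum i; rewrite -expr2 sqrf_eq0 => /eqP.
Qed.

Lemma enormZ (R : realType) (n : nat) (a : R) (v : 'cV[R]_n) :
  enorm (a *: v) = `|a| * enorm v.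
Proof.
apply/eqP; rewrite -(@eqrXn2 _ 2) ?mulr_ge0 ?enorm_ge0 //.
by rewrite exprMn !sqr_enorm dotZl dotZr mulrA -expr2 real_normK ?num_real.
Qed.

(** The quadratic form is nonnegative on the plane spanned by [u] and [v]. It may be degenerate
    there, which forces a case split on its diagonal values. Taking [B] to be the identity gives the
    usual Cauchy-Schwarz inequality. *)
Lemma psd_cauchy_schwarz (R : realType) (n : nat) (B : 'M[R]_n)
    (u v : 'cV[R]_n) :
  B^T = B -> (forall w, 0 <= dot w (B *m w)) ->
  dot u (B *m v) ^+ 2 <= dot u (B *m u) * dot v (B *m v).
Proof.
move=> symB psdB.
have expand s t : dot (s *: u + t *: v) (B *m (s *: u + t *: v)) =
    s ^+ 2 * dot u (B *m u) + 2 * s * t * dot u (B *m v)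
    + t ^+ 2 * dot v (B *m v).
  rewrite mulmxDr -!scalemxAr !dotDl !dotDr !dotZl !dotZr.
  by rewrite [dot v (B *m u)]dot_mulmxr symB (dotC _ u); ring.
have ge0 s t := psdB (s *: u + t *: v).
have a0 := psdB u; have c0 := psdB v.
move: expand ge0 a0 c0; set a := dot u (B *m u); set b := dot u (B *m v).
set c := dot v (B *m v) => expand ge0.
(* The form equals [a * (a * c - b ^+ 2)] at [(s, t) = (- b, a)] and [c * (a * c - b ^+ 2)] at
   [(c, - b)]. If [a = c = 0], its value [- 2 * b ^+ 2] at [(1, - b)] forces [b = 0]. *)
rewrite le_eqVlt => /predU1P[a0|a0]; last first.
  by have := ge0 (- b) a; rewrite expand; nra.
rewrite le_eqVlt => /predU1P[c0|c0]; last first.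
  by have := ge0 c (- b); rewrite expand; nra.
by have := ge0 1 (- b); rewrite expand -a0 -c0; nra.
Qed.

Lemma dot_le_enorm (R : realType) (n : nat) (u v : 'cV[R]_n) :
  dot u v <= enorm u * enorm v.
Proof.
apply: le_trans (ler_norm _) _.
rewrite -ler_sqr ?nnegrE ?mulr_ge0 ?enorm_ge0 //.
rewrite real_normK ?num_real // exprMn !sqr_enorm.
have := @psd_cauchy_schwarz R n 1%:M u v (trmx1 _ _).
by rewrite !mul1mx; apply => w; rewrite mul1mx dotvv_ge0.
Qed.

Lemma ler_enormD (R : realType) (n : nat) (u v : 'cV[R]_n) :
  enorm (u + v) <= enorm u + enorm v.
Proof.
rewrite -ler_sqr ?nnegrE ?addr_ge0 ?enorm_ge0 //.
rewrite sqr_enorm dotDl !dotDr (dotC v u) sqrrD !sqr_enorm.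
by have := dot_le_enorm u v; lra.
Qed.

Lemma ler_enorm_sum (R : realType) (n : nat) (I : Type) (r : seq I)
    (F : I -> 'cV[R]_n) :
  enorm (\sum_(i <- r) F i) <= \sum_(i <- r) enorm (F i).
Proof.
elim/big_ind2: _ => [|u a v b ua vb|//]; first by rewrite enorm0.
by apply: le_trans (ler_enormD _ _) _; rewrite lerD.
Qed.

Lemma enormN (R : realType) (n : nat) (v : 'cV[R]_n) : enorm (- v) = enorm v.
Proof. by rewrite -scaleN1r enormZ normrN1 mul1r. Qed.

Lemma norm_coord_le_enorm (R : realType) (n : nat) (v : 'cV[R]_n) (i : 'I_n) :
  `|v i 0| <= enorm v.
Proof.
rewrite -sqrtr_sqr ler_wsqrtr // (bigD1 i) //= lerDl sumr_ge0 // => j _.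
exact: sqr_ge0.
Qed.

(** * Boundedness of matrices and the operator norm *)

Lemma enorm_mulmx_bounded (R : realType) (m n : nat) (A : 'M[R]_(m, n)) :
  exists2 K, 0 < K & forall v, enorm (A *m v) <= K * enorm v.
Proof.
(* A crude constant suffices; the summand 1 keeps it positive even when [A] is zero. *)
exists (1 + \sum_j enorm (col j A)).
  by rewrite ltr_pwDl // sumr_ge0 // => j _; exact: enorm_ge0.
move=> v; have -> : A *m v = \sum_j v j 0 *: col j A.
  apply/colP => i; rewrite mxE summxE; apply: eq_bigr => j _.
  by rewrite !mxE mulrC.
apply: le_trans (ler_enorm_sum _ _) _; rewrite mulrDl mul1r mulr_suml.
apply: ler_wpDl; first exact: enorm_ge0.
apply: ler_sum => j _.
by rewrite enormZ mulrC ler_wpM2l ?enorm_ge0 ?norm_coord_le_enorm.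
Qed.

Lemma opnorm_has_ubound (R : realType) (m n : nat) (A : 'M[R]_(m, n)) :
  has_ubound [set enorm (A *m v) | v in [set v : 'cV[R]_n | enorm v <= 1]].
Proof.
have [K K0 AK] := enorm_mulmx_bounded A.
exists K => _ [v /= v1 <-]; apply: le_trans (AK v) _.
by rewrite ler_piMr // ltW.
Qed.

Lemma opnorm_ge0 (R : realType) (m n : nat) (A : 'M[R]_(m, n)) : 0 <= opnorm A.
Proof.
apply: ub_le_sup; first exact: opnorm_has_ubound.
by exists 0; rewrite /= ?enorm0 // mulmx0 enorm0.
Qed.

Lemma enorm_mulmx_le_opnorm (R : realType) (m n : nat) (A : 'M[R]_(m, n))
    (v : 'cV[R]_n) : enorm (A *m v) <= opnorm A * enorm v.
Proof.
have [->|v0] := eqVneq v 0; first by rewrite mulmx0 !enorm0 mulr0.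
have nv0 : 0 < enorm v by rewrite enorm_gt0.
rewrite -ler_pdivrMr //; apply: ub_le_sup; first exact: opnorm_has_ubound.
have nV : `|(enorm v)^-1| = (enorm v)^-1 by rewrite ger0_norm // invr_ge0 ltW.
exists ((enorm v)^-1 *: v) => /=; first by rewrite enormZ nV mulVf ?gt_eqF.
by rewrite -scalemxAr enormZ nV mulrC.
Qed.

(** Cauchy-Schwarz gives [|Q^T b|^2 = <b, Q Q^T b> <= |b| |Q Q^T b|], and [Q] preserves norms, so
    one factor [|Q^T b|] cancels. *)
Lemma enorm_isometry_tr_le (R : realType) (m n : nat) (Q : 'M[R]_(m, n))
    (b : 'cV[R]_m) : Q^T *m Q = 1%:M -> enorm (Q^T *m b) <= enorm b.
Proof.
move=> QQ; have := dot_le_enorm b (Q *m (Q^T *m b)).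
have -> : enorm (Q *m (Q^T *m b)) = enorm (Q^T *m b).
  apply/eqP; rewrite -(@eqrXn2 _ 2) ?enorm_ge0 // !sqr_enorm dot_mulmxr.
  by rewrite [Q^T *m (Q *m _)]mulmxA QQ mul1mx.
rewrite dot_mulmxr -sqr_enorm.
by have := enorm_ge0 b; have := enorm_ge0 (Q^T *m b); nra.
Qed.

(** * The smallest singular value as a lower bound on stretching *)

(* If [B] were invertible, Cauchy-Schwarz for the form [dot v (B *m v)] would
   give [|B v|^2 <= M * dot v (B *m v)], making the form coercive. *)
Lemma psd_unit_coercive (R : realType) (n : nat) (B : 'M[R]_n) :
  B^T = B -> (forall w, 0 <= dot w (B *m w)) -> B \in unitmx ->
  exists2 c, 0 < c & forall v, c * enorm v ^+ 2 <= dot v (B *m v).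
Proof.
move=> symB psdB unitB.
have [M M0 BM] := enorm_mulmx_bounded B.
have [K K0 BK] := enorm_mulmx_bounded (invmx B).
(* With [w = B v], the constant comes from [|v|^2 <= K^2 |w|^2] and [|w|^2 <= M <v, w>]. *)
exists (K ^+ 2 * M)^-1 => [|v]; first by rewrite invr_gt0 mulr_gt0 ?exprn_gt0.
rewrite ler_pdivrMl ?mulr_gt0 ?exprn_gt0 //.
set w := B *m v.
have vw : enorm v <= K * enorm w by have := BK w; rewrite /w mulKmx.
(* Cauchy-Schwarz for the form gives [|w|^4 <= <w, B w> <v, w> <= M |w|^2 <v, w>]; divide by [|w|^2]
   when it is nonzero. *)
have ww : enorm w ^+ 2 <= M * dot v w.
  have := psd_cauchy_schwarz w v symB psdB.
  rewrite -/w -sqr_enorm.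
  have qw : dot w (B *m w) <= M * enorm w ^+ 2.
    apply: le_trans (dot_le_enorm _ _) _.
    by rewrite expr2 mulrCA ler_wpM2l ?enorm_ge0.
  have q0 := psdB v; rewrite -/w in q0.
  have := sqr_ge0 (enorm w); rewrite le_eqVlt => /predU1P[<- _|w0 cs].
    by rewrite mulr_ge0 // ltW.
  rewrite -(ler_pM2l w0) -expr2; apply: le_trans cs _.
  rewrite mulrCA mulrA; exact: ler_wpM2r.
apply: (@le_trans _ _ (K ^+ 2 * enorm w ^+ 2)).
  by rewrite -exprMn lerXn2r ?nnegrE ?mulr_ge0 ?enorm_ge0 // ltW.
by rewrite -[leRHS]mulrA ler_wpM2l // sqr_ge0.
Qed.

(* The largest [m] with [m |v|^2 <= |Z v|^2] for all [v] is an eigenvalue of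
   [Z^T *m Z]: otherwise [Z^T *m Z - m%:M] would be coercive and [m] could be
   increased. *)
Lemma min_rayleigh_singular_value (R : realType) (m n : nat)
    (Z : 'M[R]_(m, n)) : (0 < n)%N ->
  exists2 s, singular_value Z s & forall v, s * enorm v <= enorm (Z *m v).
Proof.
move=> n0.
pose S := [set a : R | forall v, a * enorm v ^+ 2 <= enorm (Z *m v) ^+ 2].
have S0 : S 0 by move=> v; rewrite mul0r sqr_ge0.
have ubS : has_ubound S.
  (* Any nonzero vector bounds [S] by its Rayleigh quotient; this one is nonzero because [0 < n]. *)
  pose v : 'cV[R]_n := const_mx 1.
  have v0 : 0 < enorm v ^+ 2.
    rewrite exprn_gt0 // enorm_gt0; apply/eqP => /colP/(_ (Ordinal n0)).
    by rewrite !mxE => /eqP; rewrite oner_eq0.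
  exists (enorm (Z *m v) ^+ 2 / enorm v ^+ 2) => a /(_ v).
  by rewrite ler_pdivlMr.
pose a := sup S.
have a0 : 0 <= a by exact: ub_le_sup.
(* The supremum is attained: each nonzero [v] merely imposes an upper bound on the members of
   [S]. *)
have Sa : S a.
  move=> v; have [->|v0] := eqVneq v 0.
    by rewrite enorm0 expr0n mulr0 sqr_ge0.
  have nv0 : 0 < enorm v ^+ 2 by rewrite exprn_gt0 // enorm_gt0.
  rewrite -ler_pdivlMr //; apply: ge_sup; first by exists 0.
  by move=> b /(_ v); rewrite ler_pdivlMr.
pose B := Z^T *m Z - a%:M.
have symB : B^T = B by rewrite /B linearB /= trmx_mul trmxK tr_scalar_mx.
have qB v : dot v (B *m v) = enorm (Z *m v) ^+ 2 - a * enorm v ^+ 2.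
  rewrite /B mulmxBl mul_scalar_mx -mulmxA -scaleNr dotDr dotZr.
  by rewrite dot_mulmxr trmxK !sqr_enorm mulNr.
have psdB v : 0 <= dot v (B *m v) by rewrite qB subr_ge0.
have nunitB : B \notin unitmx.
  apply/negP => /(psd_unit_coercive symB psdB)[c c0 Bc].
  suff : a + c <= a by rewrite gerDl leNgt c0.
  apply: ub_le_sup => // v; have := Bc v; rewrite qB; lra.
have sqrta : Num.sqrt a ^+ 2 = a by rewrite sqr_sqrtr.
exists (Num.sqrt a).
  split; first exact: sqrtr_ge0.
  by rewrite sqrta /eigenvalue /eigenspace kermx_eq0 row_free_unit.
move=> v; rewrite -ler_sqr ?nnegrE ?mulr_ge0 ?enorm_ge0 ?sqrtr_ge0 //.
by rewrite exprMn sqrta; exact: Sa.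
Qed.

Lemma singular_value_witness (R : realType) (m n : nat) (Z : 'M[R]_(m, n))
    (s : R) : singular_value Z s ->
  exists2 v, v != 0 & enorm (Z *m v) = s * enorm v.
Proof.
move=> [s0 /eigenvalueP[u uE u0]]; exists u^T.
  by apply: contraNneq u0 => /(congr1 trmx); rewrite trmxK trmx0 => ->.
apply/eqP; rewrite -(@eqrXn2 _ 2) ?mulr_ge0 ?enorm_ge0 // exprMn !sqr_enorm.
rewrite dot_mulmxr mulmxA.
(* [eigenvalueP] yields a row eigenvector; since [Z^T *m Z] is symmetric, its transpose is a column
   eigenvector. *)
have -> : Z^T *m Z *m u^T = (s ^+ 2) *: u^T.
  by apply: trmx_inj; rewrite trmx_mul trmxK trmx_mul trmxK uE linearZ /= trmxK.
by rewrite dotZl.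
Qed.

Lemma sigma_min_enorm_le (R : realType) (m n : nat) (Z : 'M[R]_(m, n))
    (v : 'cV[R]_n) : (0 < n)%N -> sigma_min Z * enorm v <= enorm (Z *m v).
Proof.
move=> /(min_rayleigh_singular_value Z)[s sZ sv].
apply: le_trans (sv v); rewrite ler_wpM2r ?enorm_ge0 //.
by apply: ge_inf => //; exists 0 => t [].
Qed.

Lemma sigma_min_gt0 (R : realType) (n : nat) (U : 'M[R]_n) :
  (0 < n)%N -> U \in unitmx -> 0 < sigma_min U.
Proof.
move=> n0 unitU; have [s sU _] := min_rayleigh_singular_value U n0.
have [K K0 UK] := enorm_mulmx_bounded (invmx U).
(* Every singular value [t] is at least [K^-1]: at its witness [v], [|v| <= K |U v| = K t |v|]. The
   set must also be shown nonempty for this bound to pass to [inf]. *)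
apply: (@lt_le_trans _ _ K^-1); first by rewrite invr_gt0.
apply: lb_le_inf => [|t /singular_value_witness[v v0 tv]]; first by exists s.
have := UK (U *m v); rewrite mulKmx // tv mulrA.
rewrite -[X in X <= _]mul1r ler_pM2r ?enorm_gt0 // => ?.
by rewrite -div1r ler_pdivrMr // mulrC.
Qed.

(** * QR factorization and the pseudo-inverse *)

Lemma reduced_QR_unitmx (R : realType) (m n : nat) (A Q : 'M[R]_(m, n))
    (U : 'M[R]_n) : reduced_QR A Q U -> \rank A = n -> U \in unitmx.
Proof.
move=> [-> _ _] rk; rewrite -row_full_unit /row_full eqn_leq rank_leq_row /=.
by rewrite -{1}rk mxrankM_maxr.
Qed.

Lemma pseudo_inverse_QR (R : realType) (m n : nat) (A Q : 'M[R]_(m, n))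
    (U : 'M[R]_n) : reduced_QR A Q U -> U \in unitmx ->
  pseudo_inverse A = invmx U *m Q^T.
Proof.
move=> [-> QQ _] unitU; have unitUt : U^T \in unitmx by rewrite unitmx_tr.
rewrite /pseudo_inverse trmx_mul -[U^T *m Q^T *m _]mulmxA (mulmxA Q^T) QQ mul1mx.
have unitUU : U^T *m U \in unitmx by rewrite unitmx_mul unitUt.
(* As [A^T A] has become [U^T U], both sides are compared after multiplication by it; each yields
   [U^T Q^T]. *)
apply: (can_inj (mulKmx unitUU)).
by rewrite mulKVmx // -mulmxA mulKVmx.
Qed.

Lemma sigma_min_pseudo_inverse_le (R : realType) (m n : nat)
    (A Q : 'M[R]_(m, n)) (U : 'M[R]_n) (b : 'cV[R]_m) :
  (0 < n)%N -> reduced_QR A Q U -> \rank A = n ->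
  sigma_min U * enorm (pseudo_inverse A *m b) <= enorm b.
Proof.
move=> n0 QR rk; have unitU := reduced_QR_unitmx QR rk.
apply: le_trans (sigma_min_enorm_le _ _ n0) _.
rewrite (pseudo_inverse_QR QR unitU) -mulmxA mulKVmx //.
by case: QR => _ QQ _; exact: enorm_isometry_tr_le.
Qed.

(** * The perturbation as a sum, and comparison with the series *)

Lemma delta_mx_sketch_mulmx (R : realType) (n : nat) (P : nat -> 'M[R]_n)
    (f : nat -> 'cV[R]_n) (k : nat) (a : 'cV[R]_k) :
  delta_mx_sketch P f k *m a =
  - \sum_(i < k) a i 0 *: ((1%:M - P i.+1) *m bdiff f i.+1).
Proof.
rewrite /delta_mx_sketch mulNmx; congr (- _); apply/colP => r.
rewrite mxE summxE; apply: eq_bigr => i _; rewrite [in RHS]mxE mulrC.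
by congr (_ * _); rewrite mxE.
Qed.

(** Nonnegativity of the tail makes every later partial sum dominate the one at [k], and this bound
    passes to the limit. *)
Lemma partial_sum_le_lim (R : realType) (u : nat -> R) (C : R) (m k : nat) :
  (m <= k)%N -> (forall j, (k <= j)%N -> 0 <= u j) ->
  \sum_(m <= j < N) u j @[N --> \oo] --> C -> \sum_(m <= j < k) u j <= C.
Proof.
move=> mk u0 uC; apply: (cvgr_to_ge uC).
near=> N.
have kN : (k <= N)%N by near: N; exact: nbhs_infty_ge.
rewrite (@big_cat_nat _ _ _ k m N) //= lerDl big_nat_cond sumr_ge0 // => j.
by rewrite andbT => /andP[kj _]; exact: u0.
Unshelve. all: by end_near. Qed.

Theorem theorem4p1 (R : realType) (n k : nat)
  (T : 'cV[R]_n -> 'cV[R]_n) (L omega : R) (p : nat) (sketched : bool)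
  (x : nat -> 'cV[R]_n) (P : nat -> 'M[R]_n)
  (Qhat : 'M[R]_(n, k)) (Rhat : 'M[R]_k)
  (epsilon C : R) (eta : nat -> R)
  (f := fun j : nat => T (x j))
  (Fhat := sketched_mx P f k)
  (alphahat := pseudo_inverse Fhat *m sketched_res P f k)
  (deltak := enorm (delta_mx_sketch P f k *m alphahat)) :
  (0 < k)%N ->
  0 < L ->
  (forall x1 x2 : 'cV[R]_n, enorm (T x1 - T x2) <= L * enorm (x1 - x2)) ->
  0 < omega -> (0 < p)%N ->
  (forall j : nat, (1 <= j <= k)%N -> masking_projection (P j)) ->
  AAP_iterates T omega p sketched P k x ->
  \rank Fhat = k ->
  f k != 0 ->
  (forall j : nat, (1 <= j <= k)%N -> bdiff x j != 0) ->
  reduced_QR Fhat Qhat Rhat ->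
  0 < epsilon -> 0 < C ->
  (* nonnegativity for j <= k is a consequence of the bounds on I - P_j *)
  (forall j : nat, (k < j)%N -> 0 <= eta j) ->
  \sum_(1 <= j < N) eta j @[N --> \oo] --> C ->
  enorm (delta_res_sketch P f k) <= epsilon * enorm (f k) ->
  (forall j : nat, (1 <= j <= k)%N ->
     opnorm (1%:M - P j) <=
       eta j * (sigma_min Rhat /
                (L * enorm (f k) * enorm (bdiff x j) * (1 + epsilon)))) ->
  deltak <= C.
Proof.
move=> k0 L0 lipT _ _ _ _ rkF fk0 dx0 QR eps0 _ eta0 sum_eta res_le P_le.
have unitR := reduced_QR_unitmx QR rkF.
have sigma0 := sigma_min_gt0 k0 unitR.
have nfk0 : 0 < enorm (f k) by rewrite enorm_gt0.
have eps1 : 0 < 1 + epsilon by lra.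
have alpha_le : sigma_min Rhat * enorm alphahat <= (1 + epsilon) * enorm (f k).
  apply: le_trans (sigma_min_pseudo_inverse_le _ k0 QR rkF) _.
  by apply: le_trans (ler_enormD _ _) _; rewrite mulrDl mul1r lerD2l.
rewrite /deltak delta_mx_sketch_mulmx enormN.
(* The upper end is [k.+1] because the range is half-open; the goal becomes a termwise comparison
   with [eta 1, ..., eta k]. *)
apply: (le_trans _ (@partial_sum_le_lim R eta C 1 k.+1 isT eta0 sum_eta)).
rewrite big_add1 big_mkord.
apply: le_trans (ler_enorm_sum _ _) _; apply: ler_sum => i _.
have jk : (1 <= i.+1 <= k)%N by rewrite ltn_ord.
have ndx0 : 0 < enorm (bdiff x i.+1) by rewrite enorm_gt0 dx0.
have df_le : enorm (bdiff f i.+1) <= L * enorm (bdiff x i.+1) by exact: lipT.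
set d := L * enorm (f k) * enorm (bdiff x i.+1) * (1 + epsilon).
have d0 : 0 < d by rewrite !mulr_gt0.
have opP_le := P_le _ jk; rewrite -/d in opP_le.
(* A nonnegative operator norm is bounded by [eta i.+1] times the positive number
   [sigma_min Rhat / d]. *)
have etai0 : 0 <= eta i.+1.
  rewrite -(pmulr_lge0 _ (divr_gt0 sigma0 d0)).
  exact: le_trans (opnorm_ge0 _) opP_le.
rewrite enormZ.
apply: (@le_trans _ _ (enorm alphahat *
    (eta i.+1 * (sigma_min Rhat / d) * (L * enorm (bdiff x i.+1))))).
  apply: ler_pM; rewrite ?enorm_ge0 ?norm_coord_le_enorm //.
  apply: le_trans (enorm_mulmx_le_opnorm _ _) _.
  by apply: ler_pM; rewrite ?enorm_ge0 ?opnorm_ge0.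
(* The Lipschitz factor [L |Delta x|] cancels against [d], leaving [eta i.+1] times a ratio that
   [alpha_le] bounds by 1. *)
have -> : enorm alphahat *
    (eta i.+1 * (sigma_min Rhat / d) * (L * enorm (bdiff x i.+1))) =
    eta i.+1 *
    (sigma_min Rhat * enorm alphahat / ((1 + epsilon) * enorm (f k))).
  by rewrite /d; field; rewrite !gt_eqF.
by rewrite ler_piMr // ler_pdivrMr ?mul1r ?mulr_gt0.
Qed.
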